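(* Let $\tau$ and $\sigma$ be types and $\delta=(d_1^{r_1},\dots,d_s^{r_s})$ be a sequence of blocks. (a) The coefficient of $m^\otimes_\tau$ in the $m^{\otimes}$-expansion of $m^\otimes_\sigma E^+_\delta$ is $\sum_{T\in \mathrm{ETBT}(\tau,(\sigma;\delta))} 1 = |\mathrm{ETBT}(\tau,(\sigma;\delta))|$. (b) The coefficient of $m^\otimes_\tau$ in the $m^{\otimes}$-expansion of $m^\otimes_\sigma E_\delta$ is $\sum_{T\in \mathrm{ETBT}(\tau,(\sigma;\delta))} \operatorname{sgn}(T)$. Here $\mathrm{ETBT}(\tau,(\sigma;\delta))$ is the set of $E$-tensor brick tabloids of shape $\tau$ and extended content $(\sigma;\delta)$.
   Context: An integer partition is a finite (possibly empty) weakly decreasing sequence of positive integers; $\ell(\lambda)$ is its number of parts and $m_k(\lambda)$ the number of parts equal to $k$. A block is an ordered pair of positive integers written $d^m$ (degree $d$, multiplicity $m$). Blocks are ordered by $a^b\ge d^e$ iff $a>d$, or $a=d$ and $b\ge e$. A type is a finite (possibly empty) weakly decreasing sequence of blocks. For $k\ge1$, $\tau|_k$ denotes the integer partition formed by the multiplicities of the blocks of $\tau$ of degree $k$; the type $\tau$ is determined by $(\tau|_k)_{k\ge1}$. The tensor diagram of $\tau$ is the sequence of partition diagrams $\mathrm{dg}(\tau|_1)\otimes\mathrm{dg}(\tau|_2)\otimes\cdots$; the $k$th component has left-justified rows of boxes of lengths the parts of $\tau|_k$. Variables: $x_{k,j}$ for $k,j\ge 1$, with $\deg x_{k,j}=k$;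 $\mathbf{x}_{k*}=(x_{k,1},x_{k,2},\dots)$. The algebra $\mathsf{P\Lambda}$ of polysymmetric functions consists of the formal series over $\mathbb{Q}$ of bounded degree in all the $x_{k,j}$ that, for each fixed $k$, are unchanged by any permutation of the variables $\mathbf{x}_{k*}$. Define $m^{\otimes}_\tau=\prod_{k\ge1}m_{\tau|_k}(\mathbf{x}_{k*})$, where $m_\lambda$ is the monomial symmetric function; as $\tau$ ranges over all types these form a basis of $\mathsf{P\Lambda}$. $E^+_d$ is the sum of all square-free monomials (no variable repeated) of degree $d$ in the variables $x_{k,j}$ (with $\deg x_{k,j}=k$); $E_d$ is the sum of the same monomials, each multiplied by $(-1)^q$ where $q$ is the number of variables in the monomial. $E^+_{d^r}$ and $E_{d^r}$ are obtained from $E^+_d$ and $E_d$ by replacing every variable $x_{k,j}$ by $x_{k,j}^r$; $E^+_\delta=\prod_{i=1}^sE^+_{d_i^{r_i}}$ and $E_\delta=\prod_{i=1}^sE_{d_i^{r_i}}$. An $E$-tensor brick tabloid (ETBT) of shape $\tau$ and extended content $(\sigma;\delta)$ is a covering $T$ of the tensor diagram of $\tau$ by labeled horizontal bricks (height $1$, each lying within a single row of a component, every box covered by exactly one brick) built as follows. Choose partitions $\lambda^{(i)}$ of $d_i$ for $i=1,\dots,s$. For each $k\ge1$, the $k$th component $\mathrm{dg}(\tau|_k)$ is covered using exactly: $m_k(\lambda^{(i)})$ bricks labeled $i$, each of length $r_i$, for each $i=1,\dots,s$; and $\ell(\sigma|_k)$ bricks labeled $0$ with lengths given by the parts of $\sigma|_k$.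 The brick labels must strictly increase from left to right in each row. Bricks with the same label and length are indistinguishable. The sign is $\operatorname{sgn}(T)=\prod_{i=1}^s(-1)^{\ell(\lambda^{(i)})}$ (so the exponent of $-1$ is the total number of bricks in $T$ with a positive label). *)

(* Defs.v *)
From HB Require Import structures.
From mathcomp Require Import all_boot all_order all_algebra.
From mathcomp Require Import finmap.
From mathcomp Require Import monalg.
From mathcomp Require Import all_classical.

Set Implicit Arguments.
Unset Strict Implicit.
Unset Printing Implicit Defensive.

Import GRing.Theory.
Local Open Scope classical_set_scope.
Local Open Scope ring_scope.

Definition posn := {n : nat | (0 < n)%N}.
HB.instance Definition _ := Countable.on posn.

(* (d, m) stands for the block d^m. *)
Definition block := (posn * posn)%type.
HB.instance Definition _ := Countable.on block.
Definition bdeg (b : block) : nat := val b.1.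
Definition bmul (b : block) : nat := val b.2.

Definition geqb (a b : block) : bool :=
  (bdeg b < bdeg a)%N || (bdeg a == bdeg b) && (bmul b <= bmul a)%N.

Record ptype := PType { blocks :> seq block; _ : sorted geqb blocks }.
HB.instance Definition _ := [isSub for blocks].
HB.instance Definition _ := [Choice of ptype by <:].

Definition restr (tau : ptype) (k : nat) : seq nat :=
  [seq bmul b | b <- tau & bdeg b == k].

Definition is_part (d : nat) (p : seq nat) : bool :=
  [&& sorted geq p, all (leq 1) p & sumn p == d].

(* (k, j) stands for the variable x_{k,j}. *)
Definition var := (posn * posn)%type.
HB.instance Definition _ := Countable.on var.

Definition mono := {cmonom var}.

Definition wdeg (u : mono) : nat := (\sum_(v <- finsupp u) val v.1 * u v)%N.

Definition sqfree (u : mono) : bool := all (fun v => u v == 1%N) (finsupp u).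

Definition series := mono -> rat.
HB.instance Definition _ := GRing.Lmodule.copy series (mono -> rat^o).

Definition decomps (u : mono) : set (mono * mono) :=
  [set p | mmul p.1 p.2 = u].

Definition series_one : series := fun u => (u == mone)%:R.

Definition series_mul (f g : series) : series :=
  fun u => \sum_(p \in decomps u) f p.1 * g p.2.

Lemma mono_supp_finite (u : mono) : finite_set [set w : mono | forall v, (w v <= u v)%N].
Proof.
pose N := (\sum_(v <- finsupp u) u v)%N.
have leN v : (u v <= N)%N.
  case: (boolP (v \in finsupp u)) => [vu|/fsfun_dflt->//].
  by rewrite /N (big_rem v) //= leq_addr.
pose g (h : {ffun finsupp u -> 'I_N.+1}) : mono :=
  mkcmonom [fsfun v : finsupp u => h v : nat | 0%N]%fset.
apply: (@sub_finite_set _ _ (range g)); last exact/finite_image/finite_finset.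
move=> w /= leu.
exists [ffun v => inord (w (val v))] => //; apply/eqP/cmP => v.
rewrite cmE fsfun_ffun; case: insubP => [x xu <-|vu] /=.
  by rewrite ffunE inordK // ltnS (leq_trans (leu _)).
by apply/esym/eqP; rewrite -leqn0 (leq_trans (leu _)) // (fsfun_dflt vu).
Qed.

Lemma decomps_finite (u : mono) : finite_set (decomps u).
Proof.
have fu := mono_supp_finite u.
apply: (sub_finite_set _ (finite_setX fu fu)) => -[a b] /= <-.
by split=> v /=; rewrite cmM ?leq_addr ?leq_addl.
Qed.

Section SeriesRing.
Implicit Types (f g h : series) (u : mono).

Let divs u := fset_set [set w : mono | forall v, (w v <= u v)%N].

Let mem_divs u w : (w \in divs u) = `[< forall v, (w v <= u v)%N >].
Proof.
rewrite in_fset_set; last exact: mono_supp_finite.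
by apply/idP/asboolP; rewrite inE.
Qed.

Let divsM u a b : mmul a b = u -> a \in divs u /\ b \in divs u.
Proof.
by move=> <-; rewrite !mem_divs; split; apply/asboolP => v;
   rewrite cmM ?leq_addr ?leq_addl.
Qed.

Let divs_refl u : u \in divs u.
Proof. by rewrite mem_divs; apply/asboolP. Qed.

Let divs_trans u w a : w \in divs u -> a \in divs w -> a \in divs u.
Proof.
rewrite !mem_divs => /asboolP wu /asboolP aw.
by apply/asboolP => v; apply: leq_trans (wu v).
Qed.

Let series_mulE u w f g : w \in divs u -> series_mul f g w =
  \sum_(a <- divs u) \sum_(b <- divs u) (f a * g b) *+ (mmul a b == w).
Proof.
move=> wu; rewrite /series_mul fsbig_finite /=; last exact: decomps_finite.
transitivity (\sum_(p <- [seq (a, b) | a <- divs u, b <- divs u]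
    | mmul p.1 p.2 == w) f p.1 * g p.2); last first.
  rewrite big_mkcond big_allpairs; apply: eq_bigr => a _; apply: eq_bigr => b _.
  by rewrite mulrb.
rewrite -[RHS]big_filter; apply: perm_big; apply: uniq_perm.
- exact: fset_uniq.
- apply/filter_uniq/allpairs_uniq; rewrite ?fset_uniq //.
  by move=> [? ?] [? ?] _ _ [-> ->].
move=> [a b]; rewrite mem_filter in_fset_set; last exact: decomps_finite.
apply/idP/andP => [|[/eqP <- _]]; last by rewrite inE.
rewrite inE /decomps /= => abw; split; first exact/eqP.
have [aw bw] := divsM abw.
by apply/allpairsP; exists (a, b); split => //=; apply: (divs_trans wu).
Qed.

Let big_pick u a (F : mono -> rat) : a \in divs u ->
  \sum_(p <- divs u) F p *+ (a == p) = F a.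
Proof.
move=> au; rewrite (big_rem a) //= eqxx mulr1n big_seq big1 ?addr0 // => p.
by rewrite mem_rem_uniq ?fset_uniq // inE => /andP[/negPf pa _]; rewrite eq_sym pa.
Qed.

Let triple u f g h := \sum_(a <- divs u) \sum_(b <- divs u) \sum_(c <- divs u)
  (f a * g b * h c) *+ (mmul (mmul a b) c == u).

Let series_mul3 u f g h :
  series_mul (series_mul f g) h u = triple u f g h.
Proof.
rewrite (series_mulE _ _ (divs_refl u)) /triple.
transitivity (\sum_(p <- divs u) \sum_(a <- divs u) \sum_(b <- divs u)
   \sum_(c <- divs u) (f a * g b * h c) *+ (mmul p c == u) *+ (mmul a b == p)).
  rewrite big_seq [RHS]big_seq; apply: eq_bigr => p pu.
  under eq_bigr do rewrite (series_mulE _ _ pu) mulr_suml -sumrMnl.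
  rewrite exchange_big; apply: eq_bigr => a _ /=.
  under eq_bigr do rewrite mulr_suml -sumrMnl.
  rewrite exchange_big; apply: eq_bigr => b _ /=; apply: eq_bigr => c _.
  by rewrite mulrnAl mulrnAC.
rewrite exchange_big; apply: eq_bigr => a _ /=.
rewrite exchange_big; apply: eq_bigr => b _ /=.
rewrite exchange_big; apply: eq_bigr => c _ /=.
have [abu|abNu] := boolP (mmul a b \in divs u).
  by rewrite (big_pick (fun p => (f a * g b * h c) *+ (mmul p c == u)) abu).
rewrite big_seq big1 => [|p pu]; last first.
  by have [abp|] := eqVneq (mmul a b) p; rewrite ?mulr0n // abp pu in abNu *.
by case: eqP => // /divsM[abu _]; rewrite abu in abNu.
Qed.

Lemma series_mulC : commutative series_mul.
Proof.
move=> f g; apply/funext => u; rewrite !(series_mulE _ _ (divs_refl u)).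
rewrite exchange_big; apply: eq_bigr => a _; apply: eq_bigr => b _ /=.
by rewrite mulrC mulmC.
Qed.

Lemma series_mulA : associative series_mul.
Proof.
move=> f g h; apply/funext => u.
rewrite series_mulC !series_mul3 /triple.
under eq_bigr do rewrite exchange_big /=.
rewrite exchange_big; apply: eq_bigr => a _ /=.
apply: eq_bigr => b _ /=; apply: eq_bigr => c _.
by rewrite [mmul _ a]mulmC mulmA [_ * f a]mulrC mulrA.
Qed.

Lemma series_mul1 : left_id series_one series_mul.
Proof.
move=> f; apply/funext => u; rewrite (series_mulE _ _ (divs_refl u)).
rewrite exchange_big /= -[RHS](big_pick f (divs_refl u)).
apply: eq_bigr => b _.
have one_u : mone \in divs u by rewrite mem_divs; apply/asboolP => v; rewrite cm1.
have := big_pick (fun a => f b *+ (mmul a b == u)) one_u.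
rewrite mul1m [b == u]eq_sym => <-.
apply: eq_bigr => a _; rewrite /series_one eq_sym.
by case: eqP => _; rewrite ?mul1r ?mul0r ?mul0rn ?mulr1n.
Qed.

Lemma series_mulDl : left_distributive series_mul +%R.
Proof.
move=> f g h; apply/funext => u.
rewrite [RHS]/GRing.add /= !(series_mulE _ _ (divs_refl u)) -big_split /=.
apply: eq_bigr => a _; rewrite -big_split; apply: eq_bigr => b _ /=.
by rewrite -mulrnDl -mulrDl.
Qed.

End SeriesRing.

HB.instance Definition _ := GRing.Zmodule_isComPzRing.Build series
  series_mulA series_mulC series_mul1 series_mulDl.

(* Permutes the variables x_{k,1}, x_{k,2}, ... by s and fixes the others. *)
Definition permvar (k : posn) (s : posn -> posn) (v : var) : var :=
  if v.1 == k then (v.1, s v.2) else v.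

Definition PLambda : set series :=
  [set f | (exists N, forall u, (N < wdeg u)%N -> f u = 0) /\
     forall (k : posn) (s : posn -> posn), bijective s ->
       forall u w : mono, (forall v, w (permvar k s v) = u v) -> f w = f u].

(* The monomial symmetric function m_lambda(x_{k,1}, x_{k,2}, ...). *)
Definition msym (k : nat) (lambda : seq nat) : series := fun u =>
  (all (fun v : var => val v.1 == k) (finsupp u) &&
   perm_eq [seq u v | v <- finsupp u] lambda)%:R.

Lemma msym_nil k : msym k [::] = 1.
Proof.
apply/funext => u; rewrite /msym /GRing.one /= /series_one; congr (nat_of_bool _)%:R.
apply/andP/eqP => [[_ /perm_nilP u0]|->]; last by rewrite mdom1.
apply/eqP/cmP => v; rewrite cm1; apply: fsfun_dflt.
by apply/negP => /(map_f u); rewrite u0.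
Qed.

(* The omitted factors, with k larger than all degrees, are 1 by msym_nil. *)
Definition mtens (tau : ptype) : series :=
  \prod_(1 <= k < (\max_(b <- blocks tau) bdeg b).+1) msym k (restr tau k).

Definition Eplus (d : nat) : series :=
  fun u => (sqfree u && (wdeg u == d))%:R.

Definition Eminus (d : nat) : series :=
  fun u => (-1) ^+ #|` finsupp u| * Eplus d u.

(* Substitution of x_{k,j}^r for every x_{k,j}, for r > 0: the monomial w is
   sent to w^r. *)
Definition powvars (r : nat) (f : series) : series :=
  fun u => \sum_(w \in [set w | expcmn w r = u]) f w.

Lemma powvarsE r f w : (0 < r)%N -> powvars r f (expcmn w r) = f w.
Proof.
move=> r0; rewrite /powvars.
have expE n (x : mono) v : expcmn x n v = (n * x v)%N.
  case: n => [|n]; first by rewrite /expcmn /= onecmE.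
  rewrite /expcmn iteropS mulSn addnC.
  by elim: n => [|n IHn] //=; rewrite mulcmE IHn mulSn addnA.
transitivity (\sum_(x \in [set w]) f x); last by rewrite fsbig_set1.
congr (\sum_(x \in _) _).
apply/seteqP; split => x /= xw; last by rewrite xw.
apply/eqP/cmP => v; move: (expE r x v); rewrite xw expE => /eqP.
by rewrite eqn_pmul2l // => /eqP.
Qed.

Definition Eplus_seq (delta : seq block) : series :=
  \prod_(b <- delta) powvars (bmul b) (Eplus (bdeg b)).

Definition Eminus_seq (delta : seq block) : series :=
  \prod_(b <- delta) powvars (bmul b) (Eminus (bdeg b)).

Definition mexpansion (f : series) (c : {fsfun ptype -> rat with 0}) : Prop :=
  f = \sum_(t <- finsupp c) c t *: mtens t.

(* f lies in PLambda, has exactly one expansion as a finite linear combination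
   of the mtens t, and the coefficient of mtens tau in it is a. *)
Definition is_mcoef (f : series) (tau : ptype) (a : rat) : Prop :=
  f \in PLambda /\ exists c, unique (mexpansion f) c /\ c tau = a.

(* (i, l) is a brick with label i and length l. *)
Definition brick := (nat * nat)%type.

(* A covering of the tensor diagram of tau is encoded by one row of bricks,
   read from left to right, for each block of tau: the block k^m of tau is a
   row of m boxes in the k-th component, and the order of tau lists the rows of
   each component from top to bottom. *)
Definition bricks_in (tau : seq block) (T : seq (seq brick)) (k : nat) :
    seq brick :=
  flatten [seq p.2 | p <- zip tau T & bdeg p.1 == k].

(* delta_i is tnth delta i with i counted from 0, so its bricks have label
   i + 1. *)
Definition required_bricks (sigma : ptype) (s : nat) (delta : s.-tuple block)
    (lambda : 'I_s -> seq nat) (k : nat) : seq brick :=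
  [seq (0%N, l) | l <- restr sigma k] ++
  flatten [seq nseq (count_mem k (lambda i)) (i.+1, bmul (tnth delta i))
          | i : 'I_s].

Definition ETBT_with (tau sigma : ptype) (s : nat) (delta : s.-tuple block)
    (lambda : 'I_s -> seq nat) (T : seq (seq brick)) : Prop :=
  [/\ size T = size tau,
      {in zip tau T, forall p, sumn (unzip2 p.2) = bmul p.1 /\
                               sorted ltn (unzip1 p.2)},
      forall i, is_part (bdeg (tnth delta i)) (lambda i) &
      forall k, (0 < k)%N ->
        perm_eq (bricks_in tau T k) (required_bricks sigma delta lambda k)].

Definition ETBT (tau sigma : ptype) (s : nat) (delta : s.-tuple block) :
    set (seq (seq brick)) :=
  [set T | exists lambda, ETBT_with tau sigma delta lambda T].

(* See sgnE for the expression in terms of the partitions lambda. *)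
Definition sgn (T : seq (seq brick)) : rat :=
  (-1) ^+ count (fun b : brick => (0 < b.1)%N) (flatten T).

Lemma sgnE tau sigma s (delta : s.-tuple block) lambda T :
  ETBT_with tau sigma delta lambda T ->
  sgn T = \prod_(i < s) (-1) ^+ size (lambda i).
Proof.
case=> szT _ partl content; rewrite prodrXr /sgn; congr (_ ^+ _).
pose P (b : brick) := (0 < b.1)%N; rewrite -[count _ _]/(count P (flatten T)).
pose K := (\max_(b <- blocks tau) bdeg b + \max_(i < s) \max_(x <- lambda i) x).+1.
have split_nat (I : eqType) (r : seq I) (h F : I -> nat) :
    {in r, forall x, 0 < h x < K}%N ->
    (\sum_(x <- r) F x = \sum_(1 <= k < K) \sum_(x <- r | h x == k) F x)%N.
  move=> hr; rewrite (exchange_big_dep predT) //= big_seq [RHS]big_seq.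
  apply: eq_bigr => x xr; under eq_bigl do rewrite eq_sym.
  by rewrite big_nat1_eq hr.
have -> : count P (flatten T) = (\sum_(p <- zip tau T) count P p.2)%N.
  rewrite count_flatten sumnE big_map -[X in \sum_(_ <- X) _](@unzip2_zip _ _ tau) ?szT //.
  by rewrite big_map.
rewrite (split_nat _ _ (fun p => bdeg p.1)); last first.
  move=> p pT; have p1 : p.1 \in blocks tau.
    by rewrite -(@unzip1_zip _ _ (blocks tau) T) ?szT //; apply: map_f.
  rewrite /K ltnS; apply/andP; split; first exact: (valP p.1.1).
  by apply: leq_trans (leq_addr _ _); apply: leq_bigmax_seq.
have sizeE i : (size (lambda i) = \sum_(1 <= k < K) count_mem k (lambda i))%N.
  rewrite -sum1_size (split_nat _ _ id) => [|x xl].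
    by apply: eq_bigr => k _; rewrite sum1_count.
  have /and3P[_ /allP/(_ x xl) x0 _] := partl i.
  rewrite x0 /K ltnS; apply: leq_trans (leq_addl _ _).
  apply: leq_trans (leq_bigmax i).
  exact: leq_bigmax_seq.
under [RHS]eq_bigr do rewrite sizeE.
rewrite exchange_big /= big_nat_cond [RHS]big_nat_cond.
apply: eq_bigr => k /andP[/andP[k0 _] _].
have /permP/(_ P) := content k k0.
rewrite count_cat !count_flatten count_map sumnE big_map big_map big_filter => ->.
rewrite (eq_count (a2 := pred0)) // count_pred0 add0n sumnE big_map big_map.
by rewrite big_enum; apply: eq_bigr => i _; rewrite count_nseq mul1n.
Qed.

Lemma finite_seqs (A : choiceType) (D : set A) (n : nat) : finite_set D ->
  finite_set [set r : seq A | (size r <= n)%N /\ {in r, forall x, D x}].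
Proof.
move=> Dfin; elim: n => [|n IHn].
  by apply: (sub_finite_set _ (finite_set1 [::])) => -[|x r] [].
have fin := finite_image (fun p : A * seq A => p.1 :: p.2) (finite_setX Dfin IHn).
apply: (@sub_finite_set _ _ ([set [::]] `|` _)); last first.
  by rewrite finite_setU; split; [exact: finite_set1 | exact: fin].
move=> [|x r] /=.
  by left.
case=> szr inD; right; exists (x, r) => //=; split=> /=.
  by apply: inD; rewrite mem_head.
by split=> // y yr; apply: inD; rewrite inE yr orbT.
Qed.

Lemma ETBT_finite tau sigma s (delta : s.-tuple block) :
  finite_set (ETBT tau sigma delta).
Proof.
pose N := (\max_(b <- blocks tau) bmul b)%N.
pose D : set brick := `I_s.+1 `*` `I_N.+1.
have Dfin : finite_set D by apply: finite_setX; exact: finite_II.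
have rowfin := finite_seqs s.+1 Dfin.
apply: (sub_finite_set _ (finite_seqs (size tau) rowfin)).
move=> T [lambda [szT rowP _ content]] /=; rewrite szT; split=> // row rowT.
have [p pT ->] : exists2 p, p \in zip tau T & row = p.2.
  move: rowT; rewrite -{1}(@unzip2_zip _ _ (blocks tau) T) ?szT // => /mapP[p].
  by exists p.
have p1 : p.1 \in blocks tau.
  by rewrite -(@unzip1_zip _ _ (blocks tau) T) ?szT //; apply: map_f.
have [sump labp] := rowP p pT.
have lab b : b \in p.2 -> (b.1 < s.+1)%N.
  move=> bp; have := content (bdeg p.1) (valP p.1.1) => /perm_mem/(_ b).
  have -> : b \in bricks_in tau T (bdeg p.1).
    by apply/flattenP; exists p.2 => //; apply/mapP; exists p; rewrite ?mem_filter ?eqxx.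
  move/esym; rewrite mem_cat => /orP[/mapP[l _ ->] //|].
  by case/flattenP => r /mapP[i _ ->] /nseqP[-> _] /=; rewrite ltnS ltn_ord.
split=> [|b bp].
  rewrite -(size_map fst) -(size_iota 0 s.+1); apply: uniq_leq_size.
    by apply: (sorted_uniq ltn_trans ltnn).
  by move=> _ /mapP[b bp ->]; rewrite mem_iota /= add0n lab.
split=> /=; first exact: lab.
rewrite ltnS; apply: leq_trans (leq_bigmax_seq _ p1 isT).
rewrite -sump; elim: (p.2) bp => //= c r IHr; rewrite inE.
by case/orP => [/eqP->|/IHr h]; rewrite ?leq_addr // (leq_trans h) ?leq_addl.
Qed.

(* Main.v *)
Require Import Defs.
From mathcomp Require Import all_boot all_order all_algebra.
From mathcomp Require Import finmap monalg.
From mathcomp Require Import all_classical.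

(** Every f in PLambda expands as the sum over types t of f(u_t) m_t, where u_t
    is any monomial of type t: the monomial series m_t is the indicator of the
    monomials of type t ([mtensE]), and f takes the same value on all of these,
    because two monomials of the same type are related by a permutation of the
    variables of each degree ([PLambda_eq]). Boundedness of the degree leaves
    finitely many types. So the coefficient of m_tau is the value of the series
    at one monomial of type tau ([PLambda_is_mcoef]); we take
    u = prod_j x_(k_j, j)^(m_j), with one variable for each block k_j^(m_j) of
    tau, that is, for each row of the tensor diagram ([canon]).

    Both kinds of elementary factors are treated at once, by giving each
    variable of a square-free monomial a weight c, with c = 1 for E^+ and
    c = -1 for E ([Esigned]). In the variables of u, the i-th factor is
    the sum of the terms c^#|B_i| prod_(j in B_i) x_(k_j, j)^(r_i) over the
    sets B_i of rows whose degrees k_j add up to d_i. Expanding the product of the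
    factors gives a sum over the families B = (B_1, .., B_s); such a family
    contributes c^(sum_i #|B_i|) exactly when the r_i placed in each row j have
    a sum at most m_j and the monomial that remains of u, the exponents left
    over in the rows, has type sigma ([mul_Esigned_coef]).

    These families are the tabloids: B_i is the set of rows with a brick
    labelled i. As labels strictly increase along a row, they determine the
    order of its bricks, a label occurs at most once in it, and the length of
    its brick labelled 0 is what the others leave uncovered. The partition
    lambda^(i) lists the degrees of the rows in B_i, so it exists exactly when
    these add up to d_i, and the content condition on the bricks labelled 0 says
    that the leftover lengths are those of sigma ([tabloid_ETBT],
    [ETBT_tabloid]). The number of positive labels is sum_i #|B_i|, which is the
    exponent of c. *)

Set Implicit Arguments.
Unset Strict Implicit.
Unset Printing Implicit Defensive.

Import GRing.Theory.
Local Open Scope classical_set_scope.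
Local Open Scope ring_scope.

(** * Monomials *)

Lemma expcmnE (w : mono) n v : expcmn w n v = (n * w v)%N.
Proof.
case: n => [|n]; first by rewrite /expcmn /= onecmE.
rewrite /expcmn iteropS mulSn addnC.
by elim: n => [|n IHn] //=; rewrite mulcmE IHn mulSn addnA.
Qed.

Lemma finsupp_codom n (x : 'I_n -> var) (u : mono) : injective x ->
  {subset finsupp u <= codom x} ->
  perm_eq (finsupp u) [seq x j | j <- enum 'I_n & x j \in finsupp u].
Proof.
move=> xI ux; apply: uniq_perm; first exact: fset_uniq.
  by rewrite map_inj_uniq // filter_uniq ?enum_uniq.
move=> v; apply/idP/mapP => [vu|[j + ->]]; last by rewrite mem_filter => /andP[].
have /codomP[j vj] := ux _ vu.
by exists j => //; rewrite mem_filter mem_enum -vj vu.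
Qed.

Definition submono (P : pred var) (u : mono) : mono :=
  mkcmonom [fsfun v in finsupp u => if P v then u v else 0%N | 0%N]%fset.

Lemma submonoE P u v : submono P u v = if P v then u v else 0%N.
Proof.
by rewrite cmE fsfun_fun; case: finsuppP => // _; case: ifP.
Qed.

(** The monomial u o p, for q the inverse of p: q is what gives the support. *)
Definition relabel (p q : var -> var) (u : mono) : mono :=
  mkcmonom [fsfun v in [fset q v | v in finsupp u]%fset => u (p v) | 0%N]%fset.

Lemma relabelE p q u v : cancel p q -> relabel p q u v = u (p v).
Proof.
move=> pK; rewrite cmE fsfun_fun; case: ifPn => // /imfsetP vn.
by apply/esym/fsfun_dflt/negP => pvu; case: vn; exists (p v).
Qed.

(** * Products of series *)

Lemma sum_seriesE (I : Type) (r : seq I) (P : pred I) (F : I -> series) (u : mono) :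
  (\sum_(i <- r | P i) F i) u = \sum_(i <- r | P i) F i u.
Proof. exact: (big_morph (fun f : series => f u)). Qed.

(** Since a determines b in a factorization a b, a product of series has a
    single contribution as soon as all other left factors are excluded. *)
Lemma series_mul_single (f g : series) (a b : mono) :
  (forall a' b', mmul a' b' = mmul a b -> a' != a -> f a' * g b' = 0) ->
  (f * g) (mmul a b) = f a * g b.
Proof.
move=> fg0; transitivity (\sum_(p \in [set (a, b)]) f p.1 * g p.2); last first.
  by rewrite fsbig_set1.
apply/esym/fsbig_widen => [_ -> //|/= -[a' b'] [/= abE]].
have [aa|/(fg0 _ _ abE)//] := eqVneq a' a => ab'.
case: ab'; rewrite aa; congr (_, _); apply/eqP/cmP => v.
have := congr1 (fun m : mono => m v) abE.
by rewrite /= !cmM aa => /addnI.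
Qed.

(** A coefficient of a product only sees the divisors of the monomial; this
    allows one to replace each elementary factor by a finite sum of terms. *)
Lemma eq_series_mul (f f' g g' : series) (u : mono) :
  (forall a : mono, (forall v, (a v <= u v)%N) -> f a = f' a) ->
  (forall a : mono, (forall v, (a v <= u v)%N) -> g a = g' a) ->
  (f * g) u = (f' * g') u.
Proof.
move=> ff' gg'; apply: eq_fsbigr => -[a b]; rewrite inE => /= abu.
by congr (_ * _); [apply: ff' => v|apply: gg' => v]; rewrite -abu cmM ?leq_addr ?leq_addl.
Qed.

Lemma eq_series_prod (I : Type) (r : seq I) (f g : I -> series) (u : mono) :
  (forall i (a : mono), (forall v, (a v <= u v)%N) -> f i a = g i a) ->
  (\prod_(i <- r) f i) u = (\prod_(i <- r) g i) u.
Proof.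
elim: r u => [|i r IHr] u fg; rewrite ?big_nil // !big_cons.
apply: eq_series_mul => a au; first exact: fg.
apply: IHr => j b ba; apply: fg => v; exact: leq_trans (ba v) (au v).
Qed.

Definition mono_term (c : rat) (w : mono) : series := fun u => c * (u == w)%:R.

Lemma mulmK (u w : mono) : divcm (mmul u w) w = u.
Proof. by apply/eqP/cmP => v; rewrite divcmE cmM addnK. Qed.

Lemma mul_mono_term (f : series) c w u :
  (f * mono_term c w) u = if mmul (divcm u w) w == u then c * f (divcm u w) else 0.
Proof.
case: eqP => [uE|uN].
  rewrite -{1}uE series_mul_single => [|a b abE aN]; first by rewrite /mono_term eqxx mulr1 mulrC.
  rewrite /mono_term; case: eqP => [bw|]; last by rewrite !mulr0.
  by rewrite -(mulmK a w) -[X in mmul a X]bw abE mulmK eqxx in aN.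
apply: fsbig1 => -[a b] /= abu; rewrite /mono_term; case: eqP => [bw|]; last by rewrite !mulr0.
by case: uN; rewrite -abu /= bw mulmK.
Qed.

Lemma mono_termM c d w w' : mono_term c w * mono_term d w' = mono_term (c * d) (mmul w w').
Proof.
apply/funext => u; rewrite mul_mono_term /mono_term mulrA [d * c]mulrC.
have -> : (u == mmul w w') = (mmul (divcm u w') w' == u) && (divcm u w' == w).
  apply/eqP/andP => [->|[/eqP uE /eqP uw]]; first by rewrite mulmK !eqxx.
  by rewrite -uE uw.
by case: ifP => //=; rewrite mulr0.
Qed.

Lemma prod_mono_term (s : nat) (c : 'I_s -> rat) (w : 'I_s -> mono) :
  \prod_i mono_term (c i) (w i) = mono_term (\prod_i c i) (\big[mmul/mone]_i w i).
Proof.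
apply: (big_rec3 (fun (f : series) a b => f = mono_term a b)) => [|i f a b _ ->].
  by apply/funext => u; rewrite /mono_term mul1r.
by rewrite mono_termM.
Qed.

(** * The type of a monomial *)

(** The value at 0 is junk: exponents on the support of a monomial are
    positive. *)
Definition posn_of (n : nat) : posn := exist _ n.-1.+1 isT.

Lemma posn_ofE n : (0 < n)%N -> val (posn_of n) = n.
Proof. by move=> n0 /=; rewrite prednK. Qed.

Definition mblocks (u : mono) : seq block :=
  [seq (v.1, posn_of (u v)) | v : var <- finsupp u].

Lemma geqb_trans : transitive geqb.
Proof.
move=> b a c; rewrite /geqb => /orP[ab|/andP[/eqP-> ab]] /orP[bc|/andP[/eqP<- bc]].
- by rewrite (ltn_trans bc ab).
- by rewrite ab.
- by rewrite bc.
- by rewrite eqxx (leq_trans bc ab) orbT.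
Qed.

Lemma geqb_total : total geqb.
Proof.
move=> a b; rewrite /geqb; case: ltngtP => //= _.
exact: leq_total.
Qed.

Lemma geqb_anti : antisymmetric geqb.
Proof.
move=> [a1 a2] [b1 b2]; rewrite /geqb /bdeg /bmul /=; case: ltngtP => //= ab1.
by move=> ab2; congr (_, _); apply: val_inj => //=; apply/eqP; rewrite eqn_leq andbC.
Qed.

Definition mtype (u : mono) : ptype :=
  PType (sort_sorted geqb_total (mblocks u)).

Lemma mtype_eq u (t : ptype) : (mtype u == t) = perm_eq (mblocks u) t.
Proof.
rewrite -val_eqE /= -(perm_sort geqb); apply/eqP/idP => [->//|].
exact: (sorted_eq geqb_trans geqb_anti (sort_sorted geqb_total _) (valP t)).
Qed.

Lemma mtype_perm u w : mtype u = mtype w <-> perm_eq (mblocks u) (mblocks w).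
Proof.
split=> [uw|]; last by move=> uw; apply/eqP; rewrite mtype_eq perm_sym perm_sort perm_sym.
have /eqP : mtype u = mtype w by [].
by rewrite mtype_eq => /perm_trans ->//; rewrite perm_sort.
Qed.

(** The formula of [restr] on an arbitrary list of blocks, so that it also
    applies to the unsorted list [mblocks u]. *)
Definition mults_in (bs : seq block) (k : nat) : seq nat :=
  [seq bmul b | b <- bs & bdeg b == k].

Lemma perm_mults_in bs bs' k :
  perm_eq bs bs' -> perm_eq (mults_in bs k) (mults_in bs' k).
Proof. by move=> bb'; apply/perm_map/perm_filter. Qed.

(** A block is a degree, which selects a component, and a multiplicity, which
    is counted there; degree 0 does not occur in a block. *)
Lemma perm_of_mults bs bs' :
  (forall k, (0 < k)%N -> perm_eq (mults_in bs k) (mults_in bs' k)) -> perm_eq bs bs'.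
Proof.
move=> h.
have cE (b : block) s : count_mem b s = count_mem (bmul b) (mults_in s (bdeg b)).
  rewrite /mults_in count_map count_filter; apply: eq_count => a /=.
  by rewrite andbC -[a == b]/((a.1 == b.1) && (a.2 == b.2)) -!val_eqE.
by apply/allP => b _ /=; rewrite !cE; apply/eqP/permP/h/(valP b.1).
Qed.

Lemma mults_mblocks (u : mono) k :
  mults_in (mblocks u) k = [seq u v | v : var <- finsupp u & val v.1 == k].
Proof.
rewrite /mults_in /mblocks filter_map -map_comp; apply/eq_in_map => v /=.
by rewrite mem_filter => /andP[_ vu]; rewrite /bmul /= prednK // lt0n cmE_neq0.
Qed.

Lemma perm_mblocks (u : mono) n (x : 'I_n -> var) : injective x ->
  {subset finsupp u <= codom x} ->
  perm_eq (mblocks u) [seq ((x j).1, posn_of (u (x j))) | j <- enum 'I_n & x j \in finsupp u].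
Proof.
move=> xI ux; rewrite /mblocks.
have /(perm_map (fun v : var => (v.1, posn_of (u v)))) := finsupp_codom xI ux.
by rewrite -map_comp.
Qed.

Lemma finsupp_submono P u v : (v \in finsupp (submono P u)) = P v && (v \in finsupp u).
Proof. by rewrite -!cmE_neq0 submonoE; case: (P v). Qed.

Lemma perm_submono P u : perm_eq (finsupp (submono P u)) [seq v <- finsupp u | P v].
Proof.
apply: uniq_perm; rewrite ?fset_uniq ?filter_uniq ?fset_uniq // => v.
by rewrite finsupp_submono mem_filter.
Qed.

Lemma msym_homogeneous k l (u : mono) : all (fun v : var => val v.1 == k) (finsupp u) ->
  msym k l u = (perm_eq [seq u v | v <- finsupp u & val v.1 == k] l)%:R.
Proof. by move=> ku; rewrite /msym ku (all_filterP ku). Qed.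

Lemma series_oneE : (1 : series) = (fun u => (u == mone)%:R).
Proof. by []. Qed.

Lemma mono_eq1 (u : mono) : (u == mone) = (finsupp u == fset0)%fset.
Proof.
apply/eqP/eqP => [->|u0]; first by rewrite mdom1.
by apply/eqP/cmP => v; rewrite cm1; apply: fsfun_dflt; rewrite u0.
Qed.

(** The factor for k involves only the variables of degree k, so that a monomial
    u splits in one way only: into its part of degree k and the rest. *)
Lemma prod_msymE (ks : seq nat) (l : nat -> seq nat) (u : mono) : uniq ks ->
  (\prod_(k <- ks) msym k (l k)) u =
  (all (fun v : var => val v.1 \in ks) (finsupp u) &&
   all (fun k => perm_eq (mults_in (mblocks u) k) (l k)) ks)%:R.
Proof.
elim: ks u => [|k ks IHks] u /=.
  move=> _; rewrite big_nil andbT series_oneE mono_eq1; congr (nat_of_bool _)%:R.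
  by rewrite -cardfs_eq0; case: (finsupp u : seq var).
case/andP => kks /IHks {}IHks; rewrite big_cons.
pose P (v : var) := val v.1 == k.
set a := submono P u; set b := submono (predC P) u.
have uE : mmul a b = u.
  by apply/eqP/cmP => v; rewrite cmM !submonoE /=; case: (P v); rewrite ?addn0.
have az a' b' : mmul a' b' = mmul a b -> a' != a ->
   msym k (l k) a' * (\prod_(j <- ks) msym j (l j)) b' = 0.
  move=> abE aN; rewrite IHks /msym -natrM mulnb.
  case: andP => // -[/andP[/allP ak _] /andP[/allP bk _]].
  case/negP: aN; apply/cmP => v; rewrite submonoE -uE -abE cmM /P.
  case: eqP => vk; last first.
    by apply: fsfun_dflt; apply/negP => /ak/eqP.
  rewrite [b' v]fsfun_dflt ?addn0 //; apply/negP => /bk.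
  by rewrite vk (negPf kks).
rewrite -{1}uE (series_mul_single az) IHks msym_homogeneous; last first.
  by apply/allP => v; rewrite finsupp_submono => /andP[].
rewrite -natrM mulnb; congr (nat_of_bool _)%:R.
have partE (Q : pred var) j : (forall v : var, val v.1 == j -> Q v) ->
    perm_eq (mults_in (mblocks (submono Q u)) j) (mults_in (mblocks u) j).
  move=> jQ; rewrite !mults_mblocks.
  apply: perm_trans (perm_map _ (perm_filter _ (perm_submono _ _))) _.
  rewrite -filter_predI.
  rewrite (eq_filter (a2 := fun v : var => val v.1 == j)); last first.
    by move=> v /=; case: eqVneq => // /eqP/jQ ->.
  have /eq_in_map -> // : {in [seq v : var <- finsupp u | val v.1 == j], submono Q u =1 u}.
  by move=> v; rewrite mem_filter submonoE => /andP[/jQ ->].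
rewrite -mults_mblocks (permPl (partE P k _)) //.
rewrite (eq_all_r (perm_mem (perm_submono _ _))) all_filter.
have -> : all (fun j => perm_eq (mults_in (mblocks b) j) (l j)) ks =
          all (fun j => perm_eq (mults_in (mblocks u) j) (l j)) ks.
  apply: eq_in_all => j jks; rewrite (permPl (partE (predC P) j _)) // => v /eqP vj.
  rewrite /= /P vj.
  by apply: contraNN kks => /eqP <-.
rewrite andbCA; congr (_ && _); apply: eq_all => v /=.
by rewrite inE /P; case: eqP.
Qed.

Lemma mults_in_nil bs k : (forall b, b \in bs -> bdeg b != k) -> mults_in bs k = [::].
Proof.
move=> bk; rewrite /mults_in; apply: size0nil; rewrite size_map size_filter.
by apply/eqP; rewrite -leqn0 leqNgt -has_count; apply/hasPn => b /bk.
Qed.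

(** The product defining [mtens t] stops at the largest degree of t, so a monomial
    on which it does not vanish has no variable of larger degree; beyond that
    degree both lists of multiplicities are empty. *)
Lemma mtensE t u : mtens t u = (mtype u == t)%:R.
Proof.
rewrite /mtens prod_msymE ?iota_uniq // mtype_eq; congr (nat_of_bool _)%:R.
set K := (\max_(b <- _) _)%N.
have tk b : b \in blocks t -> (0 < bdeg b < K.+1)%N.
  by move=> bt; rewrite (valP b.1) ltnS; apply: leq_bigmax_seq.
apply/andP/idP => [[/allP uK /allP tK]|ut].
  apply: perm_of_mults => k _; case: (boolP (k \in index_iota 1 K.+1)) => [/tK//|kK].
  have Ku : mults_in (mblocks u) k = [::].
    apply: mults_in_nil => _ /mapP[v vu ->]; apply: contraNN kK => /eqP <-.
    exact: (uK v vu).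
  have Kt : mults_in t k = [::].
    apply: mults_in_nil => b /tk; rewrite -mem_index_iota => bK.
    by apply: contraNN kK => /eqP <-.
  by rewrite Ku Kt.
split; last by apply/allP => k _; apply: perm_mults_in.
apply/allP => v vu; rewrite mem_index_iota.
apply: (tk (v.1, posn_of (u v))); rewrite -(perm_mem ut).
by apply/mapP; exists v.
Qed.

(** * Bijections realizing rearrangements *)

(** Each entry of D is sent to the entry of D' at the same position, which permutes
    the common set of entries, and all other elements are fixed. The infinitely many
    variables of a given degree need such a globally bijective extension. *)
Lemma perm_bijective (T : eqType) (D D' : seq T) : uniq D -> perm_eq D D' ->
  exists s : T -> T,
    [/\ bijective s, map s D = D' & forall j, j \notin D -> s j = j].
Proof.
move=> uD DD'; have uD' : uniq D' by rewrite -(perm_uniq DD').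
pose tr (A B : seq T) j := if j \in A then nth j B (index j A) else j.
have trK A B : uniq A -> uniq B -> perm_eq A B -> cancel (tr A B) (tr B A).
  move=> uA uB AB j; rewrite /tr; case: (boolP (j \in A)) => jA; last first.
    by rewrite -(perm_mem AB) (negPf jA).
  have lt : (index j A < size B)%N by rewrite -(perm_size AB) index_mem.
  by rewrite mem_nth // index_uniq // nth_index.
exists (tr D D'); split; last by move=> j /negPf jD; rewrite /tr jD.
  by exists (tr D' D); apply: trK => //; rewrite perm_sym.
case: D uD DD' => [|x0 D] uD DD'; first by move/perm_size: DD'; case: D' {uD'}.
apply: (@eq_from_nth _ x0); rewrite size_map ?(perm_size DD') // => i iD'.
have iD : (i < size (x0 :: D))%N by rewrite (perm_size DD').
by rewrite (nth_map x0) // /tr mem_nth // index_uniq //; apply: set_nth_default.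
Qed.

Lemma perm_map_bijective (T T' : eqType) (f g : T -> T') (D : seq T) : uniq D ->
  perm_eq (map f D) (map g D) ->
  exists s : T -> T, [/\ bijective s, {in D, forall j, g (s j) = f j} &
    forall j, j \notin D -> s j = j].
Proof.
case: D => [|x0 D'] uD.
  by exists id; split=> //; exists id.
set D := x0 :: D' in uD * => /(perm_iotaP (f x0))[Is]; rewrite size_map => IsP fE.
have : perm_eq [seq nth x0 D i | i <- Is] D.
  by rewrite (perm_trans (perm_map _ IsP)) // map_nth_iota0 ?take_size.
rewrite perm_sym => /(perm_bijective uD)[s [bs sE sD]].
exists s; split=> // j jD.
have : map (g \o s) D = map f D.
  rewrite map_comp sE fE -map_comp; apply/eq_in_map => i.
  rewrite (perm_mem IsP) mem_iota add0n => /andP[_ iD].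
  by rewrite (nth_map x0).
by move/eq_in_map; apply.
Qed.

(** Types record nonzero exponents only, while the two monomials have to be compared
    on a common set of variables; this restores the zeros. *)
Lemma perm_nonzero (s t : seq nat) : size s = size t ->
  perm_eq [seq n <- s | n != 0%N] [seq n <- t | n != 0%N] -> perm_eq s t.
Proof.
move=> st nz.
have zE (r : seq nat) : [seq n <- r | predC (fun n => n != 0%N) n] =
    nseq (size r - size [seq n <- r | n != 0%N]) 0%N.
  rewrite -[size r](count_predC (fun n => n != 0%N)) size_filter addKn -size_filter.
  by apply/all_pred1P/allP => n; rewrite mem_filter /= negbK => /andP[].
rewrite -(perm_filterC (fun n => n != 0%N) s) perm_sym.
rewrite -(perm_filterC (fun n => n != 0%N) t) !zE perm_sym.
by rewrite st (perm_size nz) perm_cat2r.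
Qed.

(** * Polysymmetric functions depend only on types *)

Lemma permvarK (k : posn) (s1 s2 : posn -> posn) :
  cancel s1 s2 -> cancel (permvar k s1) (permvar k s2).
Proof.
move=> s12 [a b]; rewrite /permvar /=.
by case: (eqVneq a k) => [->|/negPf ak] /=; rewrite ?eqxx ?ak ?s12.
Qed.

(** A permutation of the variables of one degree rearranges the list of blocks of a
    monomial, so a function of that list up to order is symmetric. *)
Lemma PLambda_mblocks (f : series) :
  (exists N, forall u, (N < wdeg u)%N -> f u = 0) ->
  (forall u w, perm_eq (mblocks u) (mblocks w) -> f u = f w) -> f \in PLambda.
Proof.
move=> fN fP; rewrite inE; split=> // k s [s' sK s'K] u w uw.
apply/esym/fP.
have wu : perm_eq (finsupp w) (map (permvar k s) (finsupp u)).
  apply: uniq_perm; rewrite ?map_inj_uniq ?fset_uniq //.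
    exact: can_inj (permvarK k sK).
  move=> v; apply/idP/mapP => [vw|[v' v'u ->]].
    exists (permvar k s' v); last by rewrite (permvarK k s'K).
    by rewrite -cmE_neq0 -uw (permvarK k s'K) cmE_neq0.
  by rewrite -cmE_neq0 uw cmE_neq0.
rewrite perm_sym /mblocks (perm_trans (perm_map _ wu)) // -map_comp.
have /eq_map -> // : (fun v : var => (v.1, posn_of (w v))) \o permvar k s
    =1 (fun v : var => (v.1, posn_of (u v))).
by move=> v /=; rewrite uw /permvar; case: ifP.
Qed.

(** In degree k the two monomials have the same nonzero exponents with the same
    multiplicities; on the finite union of the supports these agree up to a
    rearrangement, which extends to all variables of degree k. *)
Lemma degree_relabelling (u w : mono) (k : posn) : perm_eq (mblocks u) (mblocks w) ->
  exists2 s : posn -> posn, bijective s & forall j, w (k, s j) = u (k, j).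
Proof.
move=> uw; pose U := [seq v <- (finsupp u `|` finsupp w)%fset | v.1 == k].
have kU v : v \in U -> v = (k, v.2) by rewrite mem_filter => /andP[/eqP <- _]; case: v.
pose D := [seq v.2 | v <- U].
have uD : uniq D.
  rewrite map_inj_in_uniq ?filter_uniq ?fset_uniq // => v v' /kU -> /kU -> /= -> //.
have DE (y : mono) : [seq y (k, j) | j <- D] = [seq y v | v <- U].
  by rewrite -map_comp; apply/eq_in_map => v /kU ->.
have nzE (y : mono) : {subset finsupp y <= finsupp u `|` finsupp w}%fset ->
   perm_eq [seq n <- [seq y (k, j) | j <- D] | n != 0%N] (mults_in (mblocks y) (val k)).
  move=> yU; rewrite DE mults_mblocks filter_map; apply: perm_map.
  apply: uniq_perm; rewrite ?filter_uniq ?fset_uniq // => v.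
  rewrite !mem_filter /= cmE_neq0 val_eqE.
  by case: (boolP (v \in finsupp y)) => [/yU ->|_]; rewrite ?andbT ?andbF.
have [|s [bs sD sN]] := @perm_map_bijective _ _ (fun j => u (k, j)) (fun j => w (k, j)) D uD.
  apply: perm_nonzero; rewrite ?size_map //.
  rewrite (permPl (nzE _ _)); last by move=> v vu; rewrite in_fsetU vu.
  rewrite perm_sym (permPl (nzE _ _)); last by move=> v vu; rewrite in_fsetU vu orbT.
  by rewrite perm_sym; apply: perm_mults_in.
exists s => // j; case: (boolP (j \in D)) => [/sD //|jD].
have : (k, j) \notin (finsupp u `|` finsupp w)%fset.
  apply: contraNN jD => kj; apply/mapP; exists (k, j) => //.
  by rewrite mem_filter kj eqxx.
rewrite sN // in_fsetU negb_or => /andP[ku kw].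
by rewrite !fsfun_dflt.
Qed.

(** The symmetries in [PLambda] permute the variables of one degree at a time.
    Hence u is transformed into w through the monomials that agree with w in the
    degrees already treated and with u in the others. *)
Lemma PLambda_eq (f : series) u w : f \in PLambda ->
  perm_eq (mblocks u) (mblocks w) -> f u = f w.
Proof.
rewrite inE => -[_ fP] uw.
pose mix (ks : seq posn) :=
  mmul (submono (fun v => v.1 \in ks) w) (submono (fun v => v.1 \notin ks) u).
have mixE ks v : mix ks v = if v.1 \in ks then w v else u v.
  by rewrite cmM !submonoE; case: (v.1 \in ks); rewrite ?addn0.
pose U := (finsupp u `|` finsupp w)%fset.
have -> : w = mix (undup [seq v.1 | v <- U]).
  apply/eqP/cmP => v; rewrite mixE mem_undup; case: ifP => // /negP vU.
  have /negP : v \notin U by apply/negP => vU'; apply: vU; apply: map_f.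
  by move=> /negP; rewrite in_fsetU negb_or => /andP[vu vw]; rewrite !fsfun_dflt.
elim: (undup _) (undup_uniq [seq v.1 | v <- U]) => [_|k ks IHks /= /andP[kks /IHks ->]].
  by congr f; apply/eqP/cmP => v; rewrite mixE.
have [s bs sE] := degree_relabelling k uw.
apply/esym/(fP k s bs) => -[a b]; rewrite !mixE /permvar /= inE.
by case: (eqVneq a k) => [->|ak] /=; rewrite ?(negPf ak) ?eqxx ?(negPf kks) ?sE.
Qed.

Lemma wdegE u : wdeg u = (\sum_(b <- mblocks u) bdeg b * bmul b)%N.
Proof.
rewrite /wdeg /mblocks big_map big_seq [RHS]big_seq; apply: eq_bigr => v vu.
by rewrite /bmul posn_ofE // lt0n cmE_neq0.
Qed.

Lemma wdeg_incl (u : mono) (D : {fset var}) : (finsupp u `<=` D)%fset ->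
  wdeg u = (\sum_(v <- D) val v.1 * u v)%N.
Proof.
move=> uD; apply: big_fset_incl => // v _ /fsfun_dflt ->.
by rewrite muln0.
Qed.

Lemma wdegM u w : wdeg (mmul u w) = (wdeg u + wdeg w)%N.
Proof.
rewrite (@wdeg_incl u (finsupp (mmul u w))) ?(@wdeg_incl w (finsupp (mmul u w))).
- by rewrite -big_split; apply: eq_bigr => v _; rewrite cmM mulnDr.
- by rewrite mdomD fsubsetUr.
- by rewrite mdomD fsubsetUl.
Qed.

Lemma PLambda1 : (1 : series) \in PLambda.
Proof.
apply: PLambda_mblocks => [|u w uw].
  exists 0%N => u u0; rewrite series_oneE; case: eqP => // u1.
  by rewrite u1 /wdeg mdom1 big_seq_fset0 in u0.
rewrite series_oneE !mono_eq1 -!cardfs_eq0; congr (_ == _)%:R.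
by have := perm_size uw; rewrite !size_map.
Qed.

(** A permutation p of the variables acts on the factorizations of a monomial, by
    (a, b) |-> (a o p, b o p). *)
Lemma PLambdaM (f g : series) : f \in PLambda -> g \in PLambda -> f * g \in PLambda.
Proof.
rewrite !inE => -[[N fN] fP] [[M gM] gP]; split.
  exists (N + M)%N => u uNM; apply: fsbig1 => -[a b] /= abu.
  have : (N < wdeg a)%N || (M < wdeg b)%N.
    move: uNM; rewrite -abu /= wdegM; case: (ltnP N (wdeg a)) => //= aN.
    case: (ltnP M (wdeg b)) => //= bM.
    by rewrite ltnNge leq_add.
  by case/orP => [/fN ->|/gM ->]; rewrite ?mul0r ?mulr0.
move=> k s bs u w uw.
have [s' sK s'K] := bs.
pose p := permvar k s; pose q := permvar k s'.
have pqK : cancel p q by exact: permvarK.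
have qpK : cancel q p by exact: permvarK.
pose h (ab : mono * mono) := (relabel p q ab.1, relabel p q ab.2).
rewrite [LHS]/(series_mul _ _ _) [RHS](reindex_fsbig h (decomps w)).
  by apply: eq_fsbigr => -[a b] _ /=; congr (_ * _); [apply: (fP k s)|apply: (gP k s)] => // v;
     rewrite relabelE.
split=> [[a b] /= abw|[a b] [a' b'] _ _ [/eqP/cmP aa /eqP/cmP bb]|[a b] /= abu].
- apply/eqP/cmP => v; rewrite cmM !relabelE // -uw -abw cmM //.
- by congr (_, _); apply/eqP/cmP => v; [have := aa (q v)|have := bb (q v)];
     rewrite !relabelE // qpK.
- exists (relabel q p a, relabel q p b).
    by apply/eqP/cmP => v; rewrite cmM !relabelE // -[v in RHS]qpK uw -abu cmM.
  by congr (_, _); apply/eqP/cmP => v; rewrite !relabelE // pqK.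
Qed.

Lemma PLambda_prod (I : Type) (r : seq I) (F : I -> series) :
  (forall i, F i \in PLambda) -> \prod_(i <- r) F i \in PLambda.
Proof.
move=> FP; apply: (big_ind (fun f : series => f \in PLambda)) => // [|f g].
  exact: PLambda1.
exact: PLambdaM.
Qed.

Lemma mtens_PLambda t : mtens t \in PLambda.
Proof.
apply: PLambda_mblocks => [|u w /mtype_perm uw]; last by rewrite !mtensE uw.
exists (\sum_(b <- blocks t) bdeg b * bmul b)%N => u; rewrite mtensE mtype_eq wdegE.
by case: (boolP (perm_eq _ _)) => // ut; rewrite (perm_big _ ut) ltnn.
Qed.

(** * Monomials with prescribed exponents *)

(** The monomial prod_i x_i ^ (a_i). *)
Definition fnmono (n : nat) (x : 'I_n -> var) (a : 'I_n -> nat) : mono :=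
  \big[mmul/mone]_i expcmn (ucm (x i)) (a i).

Lemma mprodE (I : finType) (F : I -> mono) v :
  (\big[mmul/mone]_i F i) v = (\sum_i F i v)%N.
Proof. by apply: (big_morph (fun m : mono => m v)) => [m m'|]; rewrite ?cmM ?cm1. Qed.

Lemma fnmonoE n (x : 'I_n -> var) a j : injective x -> fnmono x a (x j) = a j.
Proof.
move=> xI; rewrite mprodE (bigD1 j) //= expcmnE ucmE eqxx muln1 big1 ?addn0 // => i ij.
by rewrite expcmnE ucmE (inj_eq xI) (negPf ij) muln0.
Qed.

Lemma fnmono_supp n (x : 'I_n -> var) a : {subset finsupp (fnmono x a) <= codom x}.
Proof.
move=> v; rewrite -cmE_neq0 mprodE; apply: contraNT => vx.
rewrite big1 // => i _; rewrite expcmnE ucmE; case: eqP => [xi|]; rewrite ?muln0 //.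
by rewrite -xi codom_f in vx.
Qed.

(** One variable for each row: the index [i.+1] separates rows of the same
    degree, also those that are equal as blocks. *)
Definition rowvar (t : seq block) (i : 'I_(size t)) : var :=
  ((tnth (in_tuple t) i).1, posn_of i.+1).

Lemma rowvar_inj t : injective (@rowvar t).
Proof. by move=> i j [_] ij; apply: val_inj. Qed.

(** A monomial of type t in which the rows of the diagram of t are told apart. *)
Definition canon (t : seq block) : mono :=
  fnmono (@rowvar t) (fun i => bmul (tnth (in_tuple t) i)).

Lemma mblocks_canon (t : seq block) : perm_eq (mblocks (canon t)) t.
Proof.
apply: perm_trans (perm_mblocks (@rowvar_inj t) (@fnmono_supp _ _ _)) _.
have all_in : all (fun j => rowvar j \in finsupp (canon t)) (enum 'I_(size t)).
  by apply/allP => j _; rewrite -cmE_neq0 fnmonoE -?lt0n ?(valP (_.2)) //; apply: rowvar_inj.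
rewrite (all_filterP all_in) -[X in perm_eq _ X](map_tnth_enum (in_tuple t)).
have /eq_map -> // : (fun j => ((rowvar j).1, posn_of (canon t (rowvar j)))) =1
  tnth (in_tuple t).
move=> j; rewrite fnmonoE; last exact: rowvar_inj.
rewrite /rowvar /=; case: (tnth _ j) => b1 b2; congr (_, _).
by apply: val_inj; rewrite posn_ofE // (valP b2).
Qed.

Lemma mtype_canon (t : ptype) : mtype (canon t) = t.
Proof. by apply/eqP; rewrite mtype_eq mblocks_canon. Qed.

(** * Expansions *)

Lemma mexpansion_eval (c : {fsfun ptype -> rat with 0}) u :
  (\sum_(t <- finsupp c) c t *: mtens t) u = c (mtype u).
Proof.
have -> : (\sum_(t <- finsupp c) c t *: mtens t) u =
          \sum_(t <- finsupp c) c t * (mtype u == t)%:R.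
  by rewrite sum_seriesE; apply: eq_bigr => t _; rewrite -mtensE.
case: (finsuppP c (mtype u)) => [cu|cu].
  rewrite big_seq big1 // => t tc; case: eqP => [ut|]; last by rewrite mulr0.
  by rewrite ut tc in cu.
rewrite (big_fsetD1 _ cu) /= eqxx mulr1 big_seq big1 ?addr0 // => t.
by rewrite in_fsetD1 eq_sym => /andP[/negPf -> _]; rewrite mulr0.
Qed.

(** Degrees and multiplicities are positive, so each block contributes at least 1
    and both of its entries are at most N. *)
Lemma finite_bounded_types N :
  finite_set [set t : ptype | (\sum_(b <- blocks t) bdeg b * bmul b <= N)%N].
Proof.
pose D := [set b : block | (bdeg b < N.+1)%N /\ (bmul b < N.+1)%N].
have Dfin : finite_set D.
  apply: (sub_finite_set _ (finite_image (fun p : nat * nat => (posn_of p.1, posn_of p.2) : block)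
           (finite_setX (finite_II N.+1) (finite_II N.+1)))).
  move=> [[b1 p1] [b2 p2]] [/= lb1 lb2]; exists (b1, b2) => //.
  by congr (_, _); apply: val_inj; rewrite posn_ofE.
have := finite_preimage (f := blocks) _ (finite_seqs N Dfin).
move=> fin; apply: sub_finite_set (fin _); last by move=> t t' _ _ /val_inj.
move=> t /= tN.
have le1 b : (0 < bdeg b * bmul b)%N by rewrite muln_gt0 (valP b.1) (valP b.2).
split.
  apply: leq_trans tN; rewrite -sum1_size; apply: leq_sum => b _; exact: le1.
move=> b bt; move: tN; rewrite (big_rem b) //= => tN.
have bN : (bdeg b * bmul b <= N)%N by apply: leq_trans tN; apply: leq_addr.
by split; rewrite /= ltnS; apply: leq_trans bN;
   rewrite ?leq_pmulr ?leq_pmull ?(valP b.1) ?(valP b.2).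
Qed.

(** The value at a monomial of the linear combination with coefficients c is
    c(t) for t the type of the monomial, which gives existence and uniqueness of
    the expansion together. *)
Theorem PLambda_is_mcoef (f : series) tau : f \in PLambda -> is_mcoef f tau (f (canon tau)).
Proof.
move=> fP; split=> //.
pose S := [set t : ptype | f (canon t) != 0].
have Sfin : finite_set S.
  have := fP; rewrite inE => -[[N fN] _].
  apply: sub_finite_set (finite_bounded_types N) => t /=; apply: contraNT.
  by rewrite -ltnNge -(perm_big _ (mblocks_canon t)) -wdegE => /fN ->.
pose c := [fsfun t in fset_set S => f (canon t) | 0 : rat]%fset : {fsfun ptype -> rat with 0}.
have cE t : c t = f (canon t).
  rewrite fsfun_fun in_fset_set //; case: ifPn => //; rewrite notin_setE /= => /negP.
  by rewrite negbK => /eqP.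
exists c; split=> //; split.
  apply/funext => u; rewrite mexpansion_eval cE; apply: PLambda_eq => //.
  by apply/mtype_perm; rewrite mtype_canon.
move=> c' fE; apply/fsfunP => t.
by rewrite cE fE mexpansion_eval mtype_canon.
Qed.

(** * Expanding the elementary factors *)

(** E^+_d for c = 1 and E_d for c = -1. *)
Definition Esigned (c : rat) (d : nat) : series :=
  fun u => c ^+ #|` finsupp u| * Eplus d u.

(** The r-th power of a square-free monomial is a monomial all of whose exponents
    are r, and its degree before substitution is the sum of the degrees of its
    variables. *)
Lemma powvars_Esigned c d r u : (0 < r)%N ->
  powvars r (Esigned c d) u =
    (all (fun v => u v == r) (finsupp u) &&
     ((\sum_(v <- finsupp u) val v.1)%N == d))%:R * c ^+ #|` finsupp u|.
Proof.
move=> r0; case: (boolP (all _ _)) => [/allP ur|urN] /=; last first.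
  rewrite mul0r; apply: fsbig1 => w /= wu; rewrite /Esigned /Eplus.
  case: (boolP (sqfree w)) => /= [/allP sw|_]; last by rewrite mulr0.
  case/negP: urN; apply/allP => v; rewrite -cmE_neq0 -wu expcmnE => vw.
  suff /sw/eqP -> : v \in finsupp w by rewrite muln1.
  by rewrite -cmE_neq0; apply: contraNN vw => /eqP ->; rewrite muln0.
pose w : mono := mkcmonom [fsfun v in finsupp u => 1%N | 0%N]%fset.
have wE v : w v = (v \in finsupp u).
  by rewrite /w cmE fsfun_fun; case: (v \in _).
have wu : expcmn w r = u.
  apply/eqP/cmP => v; rewrite expcmnE wE; case: (finsuppP u v) => [|/ur/eqP ->].
    by rewrite muln0.
  by rewrite muln1.
have sw : finsupp w = finsupp u.
  by apply/fsetP => v; rewrite -cmE_neq0 wE; case: (_ \in _).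
rewrite -{1}wu powvarsE // /Esigned /Eplus sw /sqfree sw.
have -> : all (fun v => w v == 1%N) (finsupp u).
  by apply/allP => v vu; rewrite wE vu.
rewrite mulrC /= /wdeg sw big_seq; under eq_bigr => v vu do rewrite wE vu muln1.
by rewrite -big_seq.
Qed.

Lemma powvars_Esigned_PLambda c d r : (0 < r)%N -> powvars r (Esigned c d) \in PLambda.
Proof.
move=> r0; have E u : powvars r (Esigned c d) u =
    (all (fun b => bmul b == r) (mblocks u) &&
     ((\sum_(b <- mblocks u) bdeg b)%N == d))%:R * c ^+ size (mblocks u).
  rewrite powvars_Esigned // all_map big_map size_map; congr ((_ && _)%:R * _).
  apply: eq_in_all => v vu /=; rewrite /bmul posn_ofE // lt0n cmE_neq0 //.
apply: PLambda_mblocks => [|u w uw]; last first.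
  by rewrite !E (perm_all _ uw) (perm_big _ uw) (perm_size uw).
exists (d * r)%N => u; rewrite E wdegE.
case: (boolP (all _ _)) => [/allP ur|_]; last by rewrite mul0r.
rewrite big_seq; under eq_bigr => b /ur/eqP bu do rewrite bu.
by rewrite -big_seq -big_distrl /=; case: eqP => [->|_]; rewrite ?ltnn ?mul0r.
Qed.

Lemma fnmono_eq n (x : 'I_n -> var) (u : mono) a : injective x ->
  {subset finsupp u <= codom x} ->
  (u == fnmono x a) = [forall j, u (x j) == a j].
Proof.
move=> xI ux; apply/cmP/forallP => [E j|E v]; first by rewrite E fnmonoE.
case: (boolP (v \in codom x)) => [/codomP[j ->]|vx].
  by rewrite fnmonoE //; apply/eqP.
rewrite !fsfun_dflt //; apply: contraNN vx; [exact: fnmono_supp|exact: ux].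
Qed.

(** The monomial u is an r-th power of a square-free one exactly when it is the term
    of the set B0 of its variables, and then of no other set. *)
Lemma powvars_Esigned_terms n (x : 'I_n -> var) c d r (u : mono) : injective x -> (0 < r)%N ->
  {subset finsupp u <= codom x} ->
  powvars r (Esigned c d) u =
  (\sum_(B : {set 'I_n} | (\sum_(j in B) val (x j).1)%N == d)
     mono_term (c ^+ #|B|) (fnmono x (fun j => r * (j \in B))%N)) u.
Proof.
move=> xI r0 ux; rewrite powvars_Esigned //.
pose B0 : {set 'I_n} := [set j | x j \in finsupp u]%SET.
have suppE := finsupp_codom xI ux.
rewrite (perm_all _ suppE) (perm_big _ suppE) (perm_size suppE) !big_map size_map.
rewrite big_filter size_filter big_enum_cond.
rewrite (eq_bigl (fun j => j \in B0)); last by move=> j; rewrite !inE.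
have -> : count (fun j => x j \in finsupp u) (enum 'I_n) = #|B0|.
  by rewrite -size_filter cardE /enum_mem -filter_predI; congr size;
     apply: eq_filter => j; rewrite !inE andbT.
pose A := all (fun j => (x j \in finsupp u) ==> (u (x j) == r)) (enum 'I_n).
rewrite all_map all_filter -[all _ _]/A.
have termE (B : {set 'I_n}) : mono_term (c ^+ #|B|) (fnmono x (fun j => r * (j \in B))%N) u =
  (A && (B == B0))%:R * c ^+ #|B|.
  rewrite /mono_term mulrC fnmono_eq //; congr ((nat_of_bool _)%:R * _).
  apply/forallP/andP => [E|[/allP E /eqP ->] j].
    split; [apply/allP => j _|apply/eqP/setP => j].
      rewrite -cmE_neq0 (eqP (E j)); case: (j \in B); rewrite ?muln0 ?muln1 ?eqxx ?implybT //.
    by rewrite inE -cmE_neq0 (eqP (E j)) muln_eq0 negb_or -lt0n r0 eqb0 negbK.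
  rewrite inE; have := E j (mem_enum _ _); rewrite -cmE_neq0 /=.
  by case: eqP => [->|_ /eqP ->]; rewrite ?muln0 ?muln1.
rewrite sum_seriesE (eq_bigr _ (fun B _ => termE B)).
case: A {termE} => /=; last by rewrite mul0r big1 // => B _; rewrite mul0r.
rewrite [RHS]big_mkcond [RHS](bigD1 B0) //= eqxx mul1r [X in _ = _ + X]big1 ?addr0.
  by case: eqP; rewrite ?mul1r ?mul0r.
by move=> B /negPf ->; rewrite mul0r if_same.
Qed.

(** Distributing the product of the sums over sets B_i gives a sum over the families
    B; the term of a family then contributes when its monomial divides the given
    one, through the value of F at the quotient. *)
Lemma mul_Esigned_eval n (x : 'I_n -> var) (F : series) c (s : nat)
    (delta : s.-tuple block) (m : 'I_n -> nat) : injective x ->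
  (F * \prod_(b <- delta) powvars (bmul b) (Esigned c (bdeg b))) (fnmono x m) =
  \sum_(B : {ffun 'I_s -> {set 'I_n}} |
      [forall i, (\sum_(j in B i) val (x j).1)%N == bdeg (tnth delta i)] &&
      [forall j, (\sum_(i | j \in B i) bmul (tnth delta i) <= m j)%N])
    c ^+ (\sum_i #|B i|) *
      F (fnmono x (fun j => m j - \sum_(i | j \in B i) bmul (tnth delta i))%N).
Proof.
move=> xI; set u := fnmono x m.
pose D i := [pred B : {set 'I_n} | (\sum_(j in B) val (x j).1)%N == bdeg (tnth delta i)].
pose r i := bmul (tnth delta i).
pose w i (B : {set 'I_n}) := fnmono x (fun j => r i * (j \in B))%N.
have -> : (F * \prod_(b <- delta) powvars (bmul b) (Esigned c (bdeg b))) u =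
          (F * \prod_(i < s) \sum_(B | D i B) mono_term (c ^+ #|B|) (w i B)) u.
  rewrite big_tuple; apply: eq_series_mul => // a0 a0u.
  apply: eq_series_prod => i a aa0.
  have {aa0 a0u} au v : (a v <= u v)%N := leq_trans (aa0 v) (a0u v).
  have ax : {subset finsupp a <= codom x}.
    move=> v va; apply: (@fnmono_supp _ x m); rewrite -/u -cmE_neq0 -lt0n.
    by apply: leq_trans (au v); rewrite lt0n cmE_neq0.
  by apply: powvars_Esigned_terms => //; exact: (valP (tnth delta i).2).
rewrite bigA_distr_big_dep.
have prodE (B : {ffun 'I_s -> {set 'I_n}}) :
    \prod_i mono_term (c ^+ #|B i|) (w i (B i)) =
    mono_term (c ^+ (\sum_i #|B i|)) (fnmono x (fun j => \sum_(i | j \in B i) r i)%N).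
  rewrite prod_mono_term prodrXr; congr mono_term; apply/eqP.
  rewrite fnmono_eq //.
    apply/forallP => j; rewrite mprodE [X in _ == X]big_mkcond /=; apply/eqP/eq_bigr => i _.
    by rewrite fnmonoE //; case: (j \in B i); rewrite ?muln0 ?muln1.
  move=> v; rewrite -cmE_neq0 mprodE; apply: contraNT => vx; rewrite big1 // => i _.
  by apply: fsfun_dflt; apply: contraNN vx; apply: fnmono_supp.
under eq_bigr do rewrite prodE.
rewrite mulr_sumr sum_seriesE.
under eq_bigr do rewrite mul_mono_term.
rewrite -big_mkcondr; apply: eq_big => [B|B _].
  congr (_ && _); apply/eqP/forallP => [E j|E].
    by rewrite -(fnmonoE m j xI) -/u -E cmM fnmonoE // leq_addl.
  apply/eqP/cmP => v; rewrite cmM divcmE.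
  have [/codomP[j ->]|vx] := boolP (v \in codom x).
    by rewrite !fnmonoE // subnK.
  have W0 : v \notin finsupp (fnmono x (fun j => \sum_(i | j \in B i) r i)%N).
    by apply: contraNN vx; apply: fnmono_supp.
  by rewrite (fsfun_dflt W0) subn0 addn0.
congr (_ * F _); apply/eqP; rewrite fnmono_eq //.
  by apply/forallP => j; rewrite divcmE !fnmonoE.
move=> v; rewrite -cmE_neq0 divcmE => uv; apply: (@fnmono_supp _ x m).
by rewrite -cmE_neq0; apply: contraNN uv => /eqP; rewrite -/u => ->.
Qed.

(** * Brick tabloids *)

Section Tabloids.
Variables (tau sigma : ptype) (s : nat) (delta : s.-tuple block).

Local Notation n := (size (blocks tau)).
Local Notation deg j := (bdeg (tnth (in_tuple (blocks tau)) j)).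
Local Notation len j := (bmul (tnth (in_tuple (blocks tau)) j)).
Local Notation r i := (bmul (tnth delta i)).
Implicit Type B : {ffun 'I_s -> {set 'I_n}}.

(** A family B says in which rows the bricks labelled i lie: [load] is the total length
    of the bricks with positive labels in row j, and [leftover] is the length
    that remains for a brick labelled 0. *)
Definition load B (j : 'I_n) := (\sum_(i | j \in B i) r i)%N.

Definition leftover B (j : 'I_n) := (len j - load B j)%N.

(** The third condition compares the leftover lengths, recorded as the exponents of
    a monomial in the row variables, with the parts of sigma in each degree. *)
Definition placement B : bool :=
  [&& [forall i, (\sum_(j in B i) deg j)%N == bdeg (tnth delta i)],
      [forall j, (load B j <= len j)%N]
    & perm_eq (mblocks (fnmono (@rowvar tau) (leftover B))) sigma].

Lemma mul_Esigned_coef c :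
  (mtens sigma * \prod_(b <- delta) powvars (bmul b) (Esigned c (bdeg b))) (canon tau) =
  \sum_(B | placement B) c ^+ (\sum_i #|B i|).
Proof.
rewrite mul_Esigned_eval; last exact: rowvar_inj.
rewrite /placement; under [RHS]eq_bigl do rewrite andbA.
rewrite [RHS]big_mkcondr; apply: eq_bigr => B _.
by rewrite mtensE mtype_eq; case: (perm_eq _ _); rewrite ?mulr1 ?mulr0.
Qed.

Definition positive_bricks (I : pred 'I_s) : seq brick :=
  [seq ((i : nat).+1, r i) | i : 'I_s <- enum 'I_s & I i].

(** A row with nothing left over has no brick labelled 0. *)
Definition tabloid_row (l : nat) (I : pred 'I_s) : seq brick :=
  nseq (0 < l) (0%N, l) ++ positive_bricks I.

Definition tabloid B : seq (seq brick) :=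
  [seq tabloid_row (leftover B j) (fun i => j \in B i) | j <- enum 'I_n].

Lemma zip_rows (U : Type) (R : 'I_n -> U) :
  zip tau [seq R j | j <- enum 'I_n] =
  [seq (tnth (in_tuple (blocks tau)) j, R j) | j <- enum 'I_n].
Proof. by rewrite -{1}[blocks tau](map_tnth_enum (in_tuple tau)) zip_map. Qed.

Lemma bricks_inE (R : 'I_n -> seq brick) k :
  bricks_in tau [seq R j | j <- enum 'I_n] k =
  flatten [seq R j | j <- enum 'I_n & deg j == k].
Proof.
by rewrite /bricks_in zip_rows filter_map -map_comp.
Qed.

Definition leftovers B k :=
  [seq leftover B j | j <- enum 'I_n & (0 < leftover B j)%N && (deg j == k)].

Lemma leftoversE B k :
  perm_eq (mults_in (mblocks (fnmono (@rowvar tau) (leftover B))) k) (leftovers B k).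
Proof.
rewrite mults_mblocks.
have := perm_filter (fun v : var => val v.1 == k)
  (finsupp_codom (@rowvar_inj tau) (@fnmono_supp _ (@rowvar tau) (leftover B))).
move/(perm_map (fnmono (@rowvar tau) (leftover B)))/perm_trans; apply.
rewrite filter_map -filter_predI -map_comp /leftovers.
have /eq_map -> : fnmono (@rowvar tau) (leftover B) \o @rowvar tau =1 leftover B.
  by move=> j /=; rewrite fnmonoE //; apply: rowvar_inj.
rewrite (eq_filter (a2 := fun j => (0 < leftover B j)%N && (deg j == k))) // => j /=.
by rewrite -cmE_neq0 fnmonoE -?lt0n 1?andbC //; apply: rowvar_inj.
Qed.

Lemma count_positive_bricks (I : pred 'I_s) (P : pred brick) :
  count P (positive_bricks I) = (\sum_(i : 'I_s | I i) P ((i : nat).+1, r i))%N.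
Proof.
by rewrite -sumn_count sumnE -map_comp !big_map big_filter big_enum_cond.
Qed.

Lemma count_tabloid B k (P : pred brick) :
  count P (bricks_in tau (tabloid B) k) =
  (count (fun l => P (0%N, l)) (leftovers B k) +
   \sum_(i < s) count_mem k [seq deg j | j in B i] * P ((i : nat).+1, r i))%N.
Proof.
rewrite bricks_inE count_flatten sumnE -map_comp big_map big_filter big_enum_cond /=.
under eq_bigr do rewrite count_cat count_positive_bricks.
rewrite big_split; congr addn.
  rewrite -sumn_count sumnE !big_map big_filter big_enum_cond big_mkcond [RHS]big_mkcond.
  apply: eq_bigr => j _; rewrite count_nseq inE andTb.
  by case: (0 < _)%N; rewrite ?muln1 ?muln0 ?if_same.
under eq_bigr do rewrite big_mkcond.
rewrite exchange_big; apply: eq_bigr => i _ /=.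
rewrite -big_mkcondr sum_nat_const; congr (_ * _)%N.
rewrite count_map -sum1_card -sum1_count big_enum_cond.
by apply: eq_bigl => j; rewrite !inE andbC.
Qed.

Lemma count_required (lambda : 'I_s -> seq nat) k (P : pred brick) :
  count P (required_bricks sigma delta lambda k) =
  (count (fun l => P (0%N, l)) (restr sigma k) +
   \sum_(i < s) count_mem k (lambda i) * P ((i : nat).+1, r i))%N.
Proof.
rewrite count_cat count_map; congr addn.
rewrite count_flatten sumnE -map_comp big_map big_enum /=.
by apply: eq_bigr => i _; rewrite count_nseq mulnC.
Qed.

(** The bricks labelled 0 on the two sides can be compared separately, and so can the
    bricks of each positive label i, which all have length r_i. *)
Lemma tabloid_contentP B lambda k :
  perm_eq (bricks_in tau (tabloid B) k) (required_bricks sigma delta lambda k) <->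
  perm_eq (leftovers B k) (restr sigma k) /\
  forall i, count_mem k [seq deg j | j in B i] = count_mem k (lambda i).
Proof.
split=> [/permP E|[/permP El Ei]]; last first.
  apply/permP => P; rewrite count_tabloid count_required El; congr addn.
  by apply: eq_bigr => i _; rewrite Ei.
split.
  apply/permP => P; have := E (fun b => (b.1 == 0%N) && P b.2).
  by rewrite count_tabloid count_required !big1 ?addn0 // => i _; rewrite muln0.
(* Counting the label alone isolates i, even when some r_i are equal. *)
move=> i; have := E (fun b => b.1 == i.+1).
rewrite count_tabloid count_required (eq_count (a2 := pred0)) // count_pred0.
rewrite [in RHS](eq_count (a2 := pred0)) // count_pred0 !add0n.
rewrite (bigD1 i) //= [in RHS](bigD1 i) //= eqxx !muln1.
have z j : j != i -> ((j : nat).+1 == i.+1) = false by move=> ji; rewrite eqSS; apply: negPf.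
by rewrite !big1 ?addn0 // => j /z ->; rewrite muln0.
Qed.

Lemma sorted_positive_bricks (I : pred 'I_s) : sorted ltn (unzip1 (positive_bricks I)).
Proof.
rewrite /positive_bricks 2!sorted_map; apply: sorted_filter.
  by move=> a b c; apply: ltn_trans.
have := iota_ltn_sorted 0 s; rewrite -val_enum_ord sorted_map.
exact: sub_sorted.
Qed.

(** Both lists increase strictly in the labels, so it is enough that they have the
    same members, and a label determines its brick. *)
Lemma filter_positive_bricks (R : seq brick) : sorted ltn (unzip1 R) ->
  {in R, forall b : brick, (0 < b.1)%N -> exists i : 'I_s, b = ((i : nat).+1, r i)} ->
  [seq b <- R | (0 < b.1)%N] =
  positive_bricks (fun i => (i : nat).+1 \in unzip1 R).
Proof.
move=> sR RP.
pose lt1 (b b' : brick) := (b.1 < b'.1)%N.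
apply: (@irr_sorted_eq _ lt1).
- by move=> a b c; apply: ltn_trans.
- by move=> a; rewrite /lt1 ltnn.
- by apply: sorted_filter; [move=> a b c; apply: ltn_trans|rewrite sorted_map in sR].
- by have := sorted_positive_bricks (fun i => (i : nat).+1 \in unzip1 R); rewrite sorted_map.
move=> b; rewrite mem_filter; apply/andP/mapP => [[b0 bR]|[i]].
  have [i bE] := RP b bR b0; exists i => //.
  by rewrite mem_filter mem_enum andbT; apply/mapP; exists b => //; rewrite bE.
rewrite mem_filter => /andP[/mapP[b' b'R b'1] _ ->]; split=> //.
have [|i' b'E] := RP b' b'R; first by rewrite -b'1.
move: b'1; rewrite b'E => -[/ord_inj ii].
by rewrite ii -b'E.
Qed.

Lemma sumn_positive_bricks (I : pred 'I_s) :
  sumn (unzip2 (positive_bricks I)) = (\sum_(i : 'I_s | I i) r i)%N.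
Proof. by rewrite sumnE !big_map big_filter big_enum_cond. Qed.

(** At most the first brick has label 0. All others have the lengths prescribed by
    their labels, so the length of the row gives the length of the first one. *)
Lemma tabloid_rowP (R : seq brick) : sorted ltn (unzip1 R) ->
  {in R, forall b : brick, (0 < b.2)%N /\
     (b.1 = 0%N \/ exists i : 'I_s, b = ((i : nat).+1, r i))} ->
  let I := fun i : 'I_s => (i : nat).+1 \in unzip1 R in
  let l := (\sum_(i : 'I_s | I i) r i)%N in
  (l <= sumn (unzip2 R))%N /\ R = tabloid_row (sumn (unzip2 R) - l) I.
Proof.
move=> sR RP I l.
have posE : [seq b <- R | (0 < b.1)%N] = positive_bricks I.
  apply: filter_positive_bricks => // b bR b0; have [_ []] := RP b bR; last by [].
  by move=> b1; rewrite b1 in b0.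
have lE : l = sumn (unzip2 [seq b <- R | (0 < b.1)%N]) by rewrite posE sumn_positive_bricks.
rewrite /tabloid_row -posE lE.
case: R sR RP {I l posE lE} => [|b R] //= sR RP.
have allR : all (fun b => 0 < b.1)%N R.
  apply/allP => b' b'R; have := order_path_min ltn_trans sR.
  by move/allP/(_ _ (map_f fst b'R)); apply: leq_ltn_trans.
have [b20 _] := RP b (mem_head _ _).
rewrite (all_filterP allR); case: posnP => b1 /=.
  by rewrite addnK b20 leq_addl; case: b b1 {sR RP b20} => b1 b2 /= ->.
by rewrite subnn leqnn.
Qed.

Lemma sorted_tabloid_row l (I : pred 'I_s) : sorted ltn (unzip1 (tabloid_row l I)).
Proof.
have srt := sorted_positive_bricks I.
rewrite /tabloid_row; case: (0 < l)%N => //=.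
rewrite path_min_sorted //; apply/allP => _ /mapP[_ /mapP[i _ ->] ->] //.
Qed.

Lemma mem_tabloid_row l (I : pred 'I_s) (i : 'I_s) :
  ((i : nat).+1 \in unzip1 (tabloid_row l I)) = I i.
Proof.
rewrite /tabloid_row /unzip1 map_cat mem_cat map_nseq mem_nseq andbF /=.
rewrite -map_comp; apply/mapP/idP => [[i' + [/ord_inj ->]]|Ii].
  by rewrite mem_filter => /andP[].
by exists i => //; rewrite mem_filter Ii mem_enum.
Qed.

Lemma tabloid_inj : injective tabloid.
Proof.
move=> B B' BB'; apply/ffunP => i; apply/setP => j.
have /eq_in_map/(_ j (mem_enum _ _)) BBj := BB'.
by rewrite -[LHS](mem_tabloid_row (leftover B j) (fun i => j \in B i)) BBj mem_tabloid_row.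
Qed.

Lemma sgn_tabloid B : sgn (tabloid B) = (-1) ^+ (\sum_i #|B i|).
Proof.
rewrite /sgn; congr (_ ^+ _); rewrite count_flatten sumnE -map_comp big_map big_enum /=.
under eq_bigr => j _.
  rewrite count_cat count_nseq mul0n add0n count_positive_bricks /= big_mkcond; over.
rewrite exchange_big; apply: eq_bigr => i _.
by rewrite -big_mkcond sum1_card.
Qed.

(** The partition [lambda i] consists of the degrees of the rows in [B i], in decreasing
    order. *)
Lemma tabloid_ETBT B : placement B -> ETBT tau sigma delta (tabloid B).
Proof.
case/and3P => /forallP degB /forallP loadB typB.
pose lambda i := sort geq [seq deg j | j in B i].
exists lambda; split.
- by rewrite size_map size_enum_ord.
- move=> p; rewrite zip_rows => /mapP[j _ ->] /=; split; last exact: sorted_tabloid_row.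
  rewrite /unzip2 map_cat sumn_cat sumn_positive_bricks map_nseq sumn_nseq.
  rewrite -[X in (_ + X)%N]/(load B j).
  have -> : (leftover B j * (0 < leftover B j) = leftover B j)%N.
    by case: (leftover B j) => // l; rewrite muln1.
  by rewrite subnK.
- move=> i; apply/and3P; split; first by apply: sort_sorted => x y; apply: leq_total.
    apply/allP => x; rewrite mem_sort => /mapP[j _ ->]; exact: (valP (tnth (in_tuple tau) j).1).
  by rewrite (perm_sumn (permEl (perm_sort _ _))) sumnE big_map big_enum.
- move=> k _; apply/tabloid_contentP; split.
    by rewrite -(permPl (leftoversE _ _)); apply: perm_mults_in.
  by move=> i; apply/esym/permP/permEl/perm_sort.
Qed.

(** The family is read off from the labels in each row; the partitions [lambda] enter
    only through their multiplicities, which count the rows of each degree in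
    [B i]. *)
Lemma ETBT_tabloid T : ETBT tau sigma delta T -> exists2 B, placement B & T = tabloid B.
Proof.
case=> lambda [szT rowP lamP content].
pose R (j : 'I_n) := nth [::] T j.
have TE : T = [seq R j | j <- enum 'I_n].
  apply: (@eq_from_nth _ [::]); first by rewrite size_map size_enum_ord.
  rewrite szT => i iT.
  by rewrite (nth_map (Ordinal iT)) ?size_enum_ord // /R nth_enum_ord.
pose B : {ffun 'I_s -> {set 'I_n}} :=
    [ffun i : 'I_s => [set j : 'I_n | (i : nat).+1 \in unzip1 (R j)]%SET].
have rowE j : (load B j <= len j)%N /\ R j = tabloid_row (leftover B j) (fun i => j \in B i).
  have [sumR sortR] : sumn (unzip2 (R j)) = len j /\ sorted ltn (unzip1 (R j)).
    apply: (rowP (tnth (in_tuple tau) j, R j)).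
    by rewrite TE zip_rows; apply: map_f; rewrite mem_enum.
  have brickP : {in R j, forall b : brick, (0 < b.2)%N /\
     (b.1 = 0%N \/ exists i : 'I_s, b = ((i : nat).+1, r i))}.
    move=> b bR; have dj : (0 < deg j)%N := valP (tnth (in_tuple tau) j).1.
    have : b \in bricks_in tau T (deg j).
      rewrite TE bricks_inE; apply/flattenP; exists (R j) => //.
      by apply: map_f; rewrite mem_filter eqxx mem_enum.
    rewrite (perm_mem (content _ dj)) mem_cat => /orP[/mapP[l /mapP[c _ ->] ->]|].
      by split; [exact: (valP c.2)|left].
    case/flattenP => _ /mapP[i _ ->] /nseqP[-> _]; split.
      exact: (valP (tnth delta i).2).
    by right; exists i.
  have [] := tabloid_rowP sortR brickP; rewrite sumR.
  have memB (i : 'I_s) : (j \in B i) = ((i : nat).+1 \in unzip1 (R j)) by rewrite ffunE inE.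
  have loadE : (\sum_(i : 'I_s | (i : nat).+1 \in unzip1 (R j)) r i)%N = load B j.
    by apply: eq_bigl => i; rewrite memB.
  rewrite loadE => leB ->; split=> //; congr (_ ++ map _ _).
  by apply: eq_filter => i; rewrite memB.
have TB : T = tabloid B by rewrite TE; apply: eq_map => j; case: (rowE j).
have contB k : (0 < k)%N -> perm_eq (leftovers B k) (restr sigma k) /\
    forall i, count_mem k [seq deg j | j in B i] = count_mem k (lambda i).
  by move=> /content; rewrite TB => /tabloid_contentP.
exists B => //; apply/and3P; split.
(* The degrees of the rows in [B i] are a rearrangement of [lambda i]: neither
   list has an entry 0, and the content decides about all others. *)
- apply/forallP => i; have /and3P[_ /allP lam1 /eqP <-] := lamP i.
  rewrite -(perm_sumn (s1 := [seq deg j | j in B i])); first by rewrite sumnE big_map big_enum.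
  apply/allP => k _; apply/eqP; case: (posnP k) => [->|k0]; last by case: (contB k k0).
  rewrite !(count_memPn _) //; first by apply/negP => /lam1.
  apply/negP => /mapP[j _]; have := valP (tnth (in_tuple tau) j).1.
  by rewrite /bdeg /= => /[swap] <-.
- by apply/forallP => j; case: (rowE j).
by apply: perm_of_mults => k k0; rewrite (permPl (leftoversE _ _)); case: (contB k k0).
Qed.

End Tabloids.

Theorem theorem67 (tau sigma : ptype) (s : nat) (delta : s.-tuple block) :
  (is_mcoef (mtens sigma * Eplus_seq delta) tau
     (\sum_(T \in ETBT tau sigma delta) (1 : rat))
   /\ \sum_(T \in ETBT tau sigma delta) (1 : rat)
      = (#|` fset_set (ETBT tau sigma delta)|)%:R)
  /\ is_mcoef (mtens sigma * Eminus_seq delta) tau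
       (\sum_(T \in ETBT tau sigma delta) sgn T).
Proof.
have coefE c (E : nat -> series) (f : seq (seq brick) -> rat) :
    E = Esigned c ->
    (forall B : {ffun 'I_s -> {set 'I_(size (blocks tau))}},
       f (@tabloid tau s delta B) = c ^+ (\sum_i #|B i|)) ->
    is_mcoef (mtens sigma * \prod_(b <- delta) powvars (bmul b) (E (bdeg b))) tau
      (\sum_(T \in ETBT tau sigma delta) f T).
  move=> -> fE.
  have -> : \sum_(T \in ETBT tau sigma delta) f T =
      (mtens sigma * \prod_(b <- delta) powvars (bmul b) (Esigned c (bdeg b))) (canon tau).
    rewrite mul_Esigned_coef.
    have -> : ETBT tau sigma delta = tabloid delta @` [set` @placement tau sigma s delta].
      apply/seteqP; split=> [T /ETBT_tabloid[B ? ->]|_ [B ? <-]]; first by exists B.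
      exact: tabloid_ETBT.
    rewrite fsbig_image; last by move=> B B' _ _; apply: tabloid_inj.
    rewrite -(@bigfs _ _ _ _ (index_enum _)) ?index_enum_uniq //; last first.
      by move=> B _; rewrite mem_index_enum.
    by apply: eq_bigr => B _; apply: fE.
  apply: PLambda_is_mcoef; apply: PLambdaM; first exact: mtens_PLambda.
  by apply: PLambda_prod => b; apply: powvars_Esigned_PLambda; exact: (valP b.2).
split; last by apply: (coefE (-1)) => // B; apply: sgn_tabloid.
split; last first.
  rewrite fsbig_finite /=; last exact: ETBT_finite.
  by rewrite big_const_seq count_predT iter_addr addr0.
apply: (coefE 1) => [|B]; last by rewrite expr1n.
by apply/funext => d; apply/funext => u; rewrite /Esigned expr1n mul1r.
Qed.
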